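(* Let $L$ be a finite union-closed family of sets with $\emptyset \in L$, regarded as a lattice ordered by inclusion, and let $n \geq 1$. If a proper join-irreducible $a$ of $L$ has a geometric neighborhood, then $(L,a)$ has the full downward matching property for the $n$-element chain $[n]$; that is, for every pair of filters $F \supseteq G$ of $[n]$ there is a decreasing matching $\sigma : \mathrm{T}(L^{[n]}, F, a) \to \mathrm{T}(L^{[n]}, G, a)$.
   Context: Such an $L$ is a lattice with join given by union and least element $\emptyset$; its proper join-irreducibles are the non-empty members $a$ of $L$ that are not the union of two members of $L$ different from $a$. (Every finite lattice is isomorphic to such a family.) For $U \subseteq \bigcup L$, the lattice neighborhood $\mathcal{N}_L(U)$ is the family of all unions of subfamilies (including the empty one) of $\{b \mid b \text{ a proper join-irreducible of } L,\ b \cap U \neq \emptyset\}$. A geometric neighborhood of $U$ is a join-subsemilattice (union-closed subfamily) $L'$ of $L$ with $L' \supseteq \mathcal{N}_L(U)$ such that $L'$, ordered by inclusion, is a geometric lattice. A geometric lattice is an atomic (every element is a join of atoms) upper semimodular lattice (if $u$ covers $v$ then for every $w$, $u \vee w$ covers $v \vee w$ or $u \vee w = v \vee w$). $[n] = \{1 < \dots < n\}$. $L^{P}$ is the set of order-preserving maps from a poset $P$ to $L$, ordered pointwise. A filter is an up-closed subset (possibly empty). For a filter $F$ of $P$, $\mathrm{T}(L^P, F, a) = \{f \in L^P \mid \text{for all } x \in P:\ f(x) \geq a \text{ iff } x \in F\}$. A decreasing matching from $Q_1$ to $Q_2$ (subsets of a poset) is a one-to-one map $\sigma: Q_1 \to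 Q_2$ with $\sigma(x) \leq x$ for all $x \in Q_1$. *)

(* Defs.v *)
From mathcomp Require Import all_boot all_order.
From mathcomp Require Import boolp classical_sets functions cardinality.

Set Implicit Arguments.
Unset Strict Implicit.
Unset Printing Implicit Defensive.

Local Open Scope classical_set_scope.

(* A family of sets is a [set (set T)] over an arbitrary ground type [T]; only
   the family has to be finite, its members may be infinite.  It is ordered by
   inclusion, and a finite union-closed family containing [set0] is a lattice
   with join [`|`] and least element [set0]; the definitions below use these
   for the join and the bottom. *)

Section Families.
Variable T : Type.
Implicit Types (L M : set (set T)) (U a b u v w : set T).

Definition proper_join_irreducible L a : Prop :=
  [/\ L a, a !=set0 &
      ~ exists b c, [/\ L b, L c, b <> a, c <> a & a = b `|` c]].

Definition lattice_neighborhood L U : set (set T) :=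
  [set v | exists2 S : set (set T),
      S `<=` [set b | proper_join_irreducible L b /\ b `&` U !=set0]
      & v = \bigcup_(b in S) b].

Definition covers M u v : Prop :=
  [/\ M u, M v, v `<` u & ~ exists w, [/\ M w, v `<` w & w `<` u]].

Definition atom M a : Prop := covers M a set0.

Definition atomic M : Prop :=
  forall u, M u ->
    exists2 S : set (set T), S `<=` [set a | atom M a] & u = \bigcup_(a in S) a.

Definition upper_semimodular M : Prop :=
  forall u v, covers M u v -> forall w, M w ->
    covers M (u `|` w) (v `|` w) \/ u `|` w = v `|` w.

(* The first three conditions make M a lattice with join [`|`] and bottom
   [set0], without which [atom], [atomic] and [upper_semimodular] would not have
   their order-theoretic meaning. *)
Definition geometric_lattice M : Prop :=
  [/\ finite_set M, setU_closed M, M set0, atomic M & upper_semimodular M].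

(* Finiteness of L' and [L' set0] follow from [L' `<=` L] (for finite L) and from
   [set0] being the empty union in the lattice neighborhood. *)
Definition geometric_neighborhood L U (L' : set (set T)) : Prop :=
  [/\ L' `<=` L, setU_closed L', lattice_neighborhood L U `<=` L'
    & geometric_lattice L'].

End Families.

Section Matchings.

Definition poset_filter d (P : porderType d) (F : set P) : Prop :=
  forall x y : P, (x <= y)%O -> F x -> F y.

Definition monotone_maps d (P : porderType d) T (L : set (set T)) :
    set (P -> set T) :=
  [set f | (forall x, L (f x)) /\ forall x y, (x <= y)%O -> f x `<=` f y].

(* T(L^P, F, a), where L^P is [monotone_maps L]. *)
Definition threshold d (P : porderType d) T (L : set (set T)) (F : set P)
    (a : set T) : set (P -> set T) :=
  [set f | monotone_maps L f /\ forall x, a `<=` f x <-> F x].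

(* The values of sigma outside Q1 are irrelevant. *)
Definition decreasing_matching X (le : X -> X -> Prop) (Q1 Q2 : set X)
    (sigma : X -> X) : Prop :=
  [/\ set_fun Q1 Q2 sigma, set_inj Q1 sigma
    & forall x, Q1 x -> le (sigma x) x].

Definition pointwise_subset (P T : Type) (f g : P -> set T) : Prop :=
  forall x, f x `<=` g x.

Definition full_downward_matching_property d (P : porderType d) T
    (L : set (set T)) (a : set T) : Prop :=
  forall F G : set P, poset_filter F -> poset_filter G -> G `<=` F ->
    exists sigma : (P -> set T) -> (P -> set T),
      decreasing_matching (@pointwise_subset P T)
        (threshold L F a) (threshold L G a) sigma.

End Matchings.

Arguments full_downward_matching_property {d} P {T} L a.

(* Main.v *)
(** For filters [G `<=` F] of the chain, a map in T(F) has to be lowered exactly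
    on the interval [F `\` G] so that it no longer dominates [a] there.  The key
    point is that, in any interval [[u, z]] of [L] with [a `<=` z] and
    [~ a `<=` u], some [y] that does not contain [a] satisfies [y `|` a = z]
    (take [y] maximal and use the exchange property of the geometric
    neighborhood).  Replacing the values on [F `\` G] from left to right by such
    [y]s is injective, because the old values are recovered by joining with [a]. *)
Require Import Defs.
From mathcomp Require Import all_boot all_order.
From mathcomp Require Import boolp classical_sets functions cardinality.

Local Open Scope classical_set_scope.

Lemma finite_set_maximal (X : Type) (R : X -> X -> Prop) (A : set X) :
  (forall x, ~ R x x) -> (forall y x z, R x y -> R y z -> R x z) ->
  finite_set A -> A !=set0 ->
  exists2 m, A m & forall y, A y -> ~ R m y.
Proof.
elim/Peq: X R A => X R A Rirr Rtrans /finite_seqP[s ->] [x0 /= x0s].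
elim: s x0 x0s => // x s IHs _ _.
have [s0|[y ys]] : s = [::] \/ exists y, y \in s.
- by case: s {IHs} => [|y s]; [left|right; exists y; rewrite mem_head].
- exists x; first exact: mem_head.
  by rewrite s0 => y /=; rewrite inE => /eqP->.
have [m ms mmax] := IHs y ys.
have [Rmx|nRmx] := pselect (R m x).
- exists x; first exact: mem_head.
  move=> z /=; rewrite inE => /orP[/eqP->//|zs Rxz].
  exact: (mmax z zs (Rtrans _ _ _ Rmx Rxz)).
- exists m; first by rewrite /= inE ms orbT.
  by move=> z /=; rewrite inE => /orP[/eqP->//|]; exact: mmax.
Qed.

Section Families.
Variable T : Type.
Implicit Types (L M : set (set T)) (a b u y z q : set T).

Lemma set_proper_trans (A B C : set T) : A `<` B -> B `<` C -> A `<` C.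
Proof.
move=> [AB nBA] [BC _]; split; first exact: subset_trans BC.
by move=> CA; apply: nBA; apply: subset_trans CA.
Qed.

(** An inclusion-minimal member of [L] below [z] through [t] works: were it a union of two other
    members, one of them would contain [t] and be smaller. *)
Lemma exists_proper_join_irreducible L z t :
  finite_set L -> L z -> z t ->
  exists b, [/\ proper_join_irreducible L b, b `<=` z & b t].
Proof.
move=> finL Lz zt.
have [||||b [Lb bz bt] bmin] := @finite_set_maximal (set T) (fun b c => c `<` b)
    [set b | [/\ L b, b `<=` z & b t]].
- by move=> b; apply: properxx.
- by move=> c b d cb dc; apply: set_proper_trans dc cb.
- by apply: sub_finite_set finL => b [].
- by exists z; split.
exists b; split=> //; split=> //; first by exists t.
move=> [c [d [Lc Ld cb db bE]]].
have sub_min e : L e -> e <> b -> e `<=` b -> ~ e t.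
  move=> Le eb sub_eb et; apply: (bmin e).
    by split=> //; apply: subset_trans bz.
  by rewrite properEneq; split=> //; apply/eqP.
have := bt; rewrite {1}bE => -[].
- by apply: sub_min => //; rewrite bE; apply: subsetUl.
- by apply: sub_min => //; rewrite bE; apply: subsetUr.
Qed.

(** By semimodularity [u] is covered by its join with the atom [q], so no room is left for the join
    of [u] and [a] strictly in between. *)
Lemma geometric_lattice_exchange M q u a :
  geometric_lattice M -> M u -> M a -> atom M q ->
  ~ a `<=` u -> a `<=` u `|` q -> q `<=` u `|` a.
Proof.
move=> [_ UM _ _ usm] Mu Ma atq au auq.
have [|] := usm q set0 atq u Mu; rewrite set0U setUC; last first.
  by move=> uqE; rewrite uqE in auq.
case=> [Muq _ _ nobetween].
apply: contrapT => nq; apply: nobetween; exists (u `|` a); split.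
- exact: UM.
- rewrite properEneq; split; last exact: subsetUl.
  by apply/eqP => E; apply: au; rewrite E; apply: subsetUr.
- rewrite properEneq; split; last by rewrite subUset; split.
  by apply/eqP => E; apply: nq; rewrite E; apply: subsetUr.
Qed.

Lemma geometric_neighborhood_complement L M a u z :
  finite_set L -> setU_closed L -> proper_join_irreducible L a ->
  geometric_neighborhood L a M ->
  L u -> L z -> u `<=` z -> a `<=` z -> ~ a `<=` u ->
  exists y, [/\ L y, u `<=` y, y `<=` z, ~ a `<=` y & y `|` a = z].
Proof.
move=> finL UL airr [ML UM NM geoM] Lu Lz uz az au.
have [||||y [Ly uy yz ay] ymax] := @finite_set_maximal (set T) (@proper T)
    [set y | [/\ L y, u `<=` y, y `<=` z & ~ a `<=` y]].
- by move=> y; apply: properxx.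
- by move=> y x w xy yw; apply: set_proper_trans xy yw.
- by apply: sub_finite_set finL => y [].
- by exists u; split.
exists y; split=> //; apply/seteqP; split; first by rewrite subUset.
move=> t zt; apply: contrapT => nyat.
(* By maximality of [y], enlarging it by any member below [z] through [t] must capture [a]. *)
have sup_max e : L e -> e `<=` z -> e t -> a `<=` y `|` e.
  move=> Le ez et; apply: contrapT => nay; apply: (ymax (y `|` e)).
    split=> //; [exact: UL | | by rewrite subUset].
    by apply: subset_trans uy _; apply: subsetUl.
  rewrite properEneq; split; last exact: subsetUl.
  by apply/eqP => E; apply: nyat; left; rewrite E; right.
have [b [birr bz bt]] := @exists_proper_join_irreducible L z t finL Lz zt.
have [Lb _ _] := birr.
have NirrM c : proper_join_irreducible L c -> c `&` a !=set0 -> M c.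
  move=> cirr ca; apply: NM; exists [set c]; last by rewrite bigcup_set1.
  by move=> _ ->.
have Ma : M a.
  by apply: NirrM => //; rewrite setIid; have [_] := airr.
(* If [b] missed [a], then [sup_max] would already put [a] inside [y]. *)
have Mb : M b.
  apply: NirrM => //; apply: contrapT => ba0; apply: ay => x ax.
  by have [//|bx] := sup_max b Lb bz bt x ax; case: ba0; exists x.
(* [y1] is the part of [y] lying in [M]; the rest of [y] misses [a]. *)
pose S := [set c | (proper_join_irreducible L c /\ c `&` a !=set0) /\ c `<=` y].
pose y1 := \bigcup_(c in S) c.
have My1 : M y1 by apply: NM; exists S => // c [].
have y1y : y1 `<=` y by apply: bigcup_sub => c [].
have ya_y1 x : y x -> a x -> y1 x.
  move=> yx ax.
  have [c [cirr cy cx]] := @exists_proper_join_irreducible L y x finL Ly yx.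
  by exists c => //; split=> //; split=> //; exists x.
have [_ _ _ atM _] := geoM.
(* Exchange needs an atom of [M], so [b] is replaced by an atom [q] below it that still contains
   [t]. *)
have [Q Qat bE] := atM b Mb.
move: (bt); rewrite bE => -[q Qq qt].
have qat : atom M q := Qat q Qq.
have Mq : M q by case: qat.
have qz : q `<=` z.
  by apply: subset_trans bz; rewrite bE; apply: bigcup_sup.
have ay1q : a `<=` y1 `|` q.
  move=> x ax; have [yx|qx] := sup_max q (ML q Mq) qz qt x ax; last by right.
  by left; apply: ya_y1.
have ny1 : ~ a `<=` y1 by move=> ay1; apply: ay; apply: subset_trans y1y.
have := @geometric_lattice_exchange M q y1 a geoM My1 Ma qat ny1 ay1q t qt.
by case=> [/y1y|] ?; apply: nyat; [left|right].
Qed.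

End Families.

(** The values of [g] are chosen from left to right, each on [F] minus [G] between the preceding
    value of [g] and [f x]; the last two clauses let [f] be recovered from [g]. *)
Lemma chain_lowering (T : Type) (L : set (set T)) (a : set T) (n : nat)
    (F G : set 'I_n) (f : 'I_n -> set T) :
  L set0 -> a !=set0 ->
  (forall u z, L u -> L z -> u `<=` z -> a `<=` z -> ~ a `<=` u ->
    exists y, [/\ L y, u `<=` y, y `<=` z, ~ a `<=` y & y `|` a = z]) ->
  poset_filter F -> poset_filter G -> G `<=` F -> threshold L F a f ->
  exists g, [/\ threshold L G a g, pointwise_subset g f,
    forall x, F x -> ~ G x -> f x = g x `|` a
    & forall x, ~ (F x /\ ~ G x) -> f x = g x].
Proof.
move=> L0 a0 compl filF filG GF [[Lf mf] fF].
(* The empty chain is treated apart, since [inord] needs a nonempty ordinal type. *)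
case: n => [|n] in F G f filF filG GF Lf mf fF *.
  by exists f; split; [split; [split|case]|move=> []|case|case].
have /choice[s sP] : forall uz : set T * set T, exists y,
    L uz.1 -> L uz.2 -> uz.1 `<=` uz.2 -> a `<=` uz.2 -> ~ a `<=` uz.1 ->
    [/\ L y, uz.1 `<=` y, y `<=` uz.2, ~ a `<=` y & y `|` a = uz.2].
  move=> [u z] /=.
  have [[Lu Lz uz az au]|nH] := pselect
    [/\ L u, L z, u `<=` z, a `<=` z & ~ a `<=` u].
    by have [y yP] := compl u z Lu Lz uz az au; exists y.
  by exists set0 => *; case: nH.
pose D (x : 'I_n.+1) := F x /\ ~ G x.
(* Indices are shifted by one: [pre k.+1] is the new value at the point [k], and [pre 0] is the
   bottom element placed before the chain. *)
pose fix pre k := if k is k'.+1 then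
    let x := inord k' in if `[< D x >] then s (pre k', f x) else f x
  else set0.
pose P k := [/\ L (pre k.+1), pre k `<=` pre k.+1, pre k.+1 `<=` f (inord k),
  D (inord k) -> pre k.+1 `|` a = f (inord k)
  & ~ G (inord k) -> ~ a `<=` pre k.+1].
(* The last premise is what makes a complement available at a point of [D]; outside both [D] and [G]
   the point is not in [F], so [f] itself avoids [a]. *)
have step k : L (pre k) -> pre k `<=` f (inord k) ->
    (~ G (inord k) -> ~ a `<=` pre k) -> P k.
  move=> Lk kf Gk; rewrite /P /=; case: asboolP => [Dk|nDk].
    have [Fk nGk] := Dk.
    have [] := sP (pre k, f (inord k)) Lk (Lf _) kf _ (Gk nGk) => //=.
    exact/fF.
  by split=> // nGk /fF Fk; case: nDk.
have leI k : (k < n)%N -> (inord k <= inord k.+1 :> 'I_n.+1)%O.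
  by move=> kn; rewrite leEord !inordK // ltnS ltnW.
have PP k : (k <= n)%N -> P k.
  elim: k => [_|k IHk kn].
    apply: step => //.
    by move=> _ a_sub; have [x /a_sub] := a0.
  have [Lk _ kf _ Gk] := IHk (ltnW kn); apply: step => //.
    by apply: subset_trans kf (mf _ _ (leI _ kn)).
  (* [G] is up-closed, so a point outside [G] has its predecessor outside [G]. *)
  by move=> nG; apply: Gk => Gk; apply: nG; apply: (filG _ _ (leI _ kn) Gk).
have Px (x : 'I_n.+1) : P x by apply: PP; rewrite -ltnS.
have pre_mono i j : (i <= j <= n.+1)%N -> pre i `<=` pre j.
  case/andP; elim: j => [|j IHj]; first by rewrite leqn0 => /eqP-> _ t.
  rewrite leq_eqVlt => /predU1P[-> _ t //|ij jn].
  have [_ prej _ _ _] := PP j jn.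
  by apply: subset_trans (IHj ij (ltnW jn)) prej.
have preE (x : 'I_n.+1) : ~ D x -> pre x.+1 = f x.
  by move=> nDx; rewrite /= inord_val asboolF.
exists (fun x : 'I_n.+1 => pre x.+1); split.
- split; first split.
  + by move=> x; have [] := Px x.
  + by move=> x y xy; apply: pre_mono; rewrite ltnS ltn_ord andbT.
  + move=> x; split=> [ax|Gx].
      apply: contrapT => nG; have [_ _ _ _] := Px x; rewrite inord_val.
      by move=> /(_ nG).
    by rewrite preE => [|[]//]; apply/fF/GF.
- by move=> x; have [_ _ + _ _] := Px x; rewrite inord_val.
- by move=> x Fx nGx; have [_ _ _ + _] := Px x; rewrite inord_val => ->.
- by move=> x nD; rewrite preE.
Qed.

Theorem corollary4p7p10 (T : Type) (L : set (set T)) (n : nat) (a : set T)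
    (finL : finite_set L) (unionL : setU_closed L) (emptyL : L set0)
    (n_ge1 : (1 <= n)%N)
    (airr : proper_join_irreducible L a)
    (ageom : exists L' : set (set T), geometric_neighborhood L a L') :
  full_downward_matching_property 'I_n L a.
Proof.
have [M geoM] := ageom; have [_ a0 _] := airr.
have compl u z := @geometric_neighborhood_complement T L M a u z
  finL unionL airr geoM.
move=> F G filF filG GF.
have /choice[sigma sigmaP] : forall f, exists g, threshold L F a f ->
    [/\ threshold L G a g, pointwise_subset g f,
      forall x, F x -> ~ G x -> f x = g x `|` a
      & forall x, ~ (F x /\ ~ G x) -> f x = g x].
  move=> f; have [Ff|nFf] := pselect (threshold L F a f); last by exists f.
  by have [g gP] := @chain_lowering T L a n F G f emptyL a0 compl filF filG GF Ff;
    exists g.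
exists sigma; split.
- by move=> f /sigmaP[].
- move=> f g /set_mem/sigmaP[_ _ fD fnD] /set_mem/sigmaP[_ _ gD gnD] sfg.
  (* The image determines the map: join with [a] on [F] minus [G], copy the value elsewhere. *)
  apply: funext => x; have [[Fx nGx]|nD] := pselect (F x /\ ~ G x).
    by rewrite fD // gD // sfg.
  by rewrite fnD // gnD // sfg.
- by move=> f /sigmaP[].
Qed.
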